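(* For each $n \in \mathbf{N}$, let $\mu_n$ be a Borel probability measure on $\mathbf{R}^n$. Assume that $\mu_1,\mu_2,\ldots$ are consistent in the sense that $\mu_{n+1}(A \times \mathbf{R}) = \mu_n(A)$ for any $n \in \mathbf{N}$ and any Borel set $A \subset \mathbf{R}^n$. Then there exists a Borel probability measure $\mu$ on $\mathbf{R}^{\mathbf{N}}$ satisfying $\mu(A \times \mathbf{R}^{\mathbf{N}}) = \mu_n(A)$ for any $n \in \mathbf{N}$ and any Borel set $A \subset \mathbf{R}^n$.
   Context: $\mathbf{N}=\{1,2,\ldots\}$. The space $\mathbf{R}^{\mathbf{N}}$ of real sequences carries the product topology and its Borel $\sigma$-field (which coincides with the product $\sigma$-field). For $A\subset\mathbf{R}^n$, the set $A\times\mathbf{R}^{\mathbf{N}}$ is regarded as a subset of $\mathbf{R}^{\mathbf{N}}$, namely the set of all sequences $(x_i)_{i\in\mathbf{N}}$ with $(x_1,\ldots,x_n)\in A$. Similarly, $A\times\mathbf{R}\subset\mathbf{R}^{n+1}$ is the set of $(x_1,\ldots,x_{n+1})$ with $(x_1,\ldots,x_n)\in A$. *)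

(* Defs.v *)
From HB Require Import structures.
From mathcomp Require Import all_boot all_order all_algebra.
From mathcomp Require Import all_classical all_reals all_analysis.

Set Implicit Arguments.
Unset Strict Implicit.
Unset Printing Implicit Defensive.

Import Order.TTheory GRing.Theory Num.Theory.
Import numFieldNormedType.Exports.

Local Open Scope classical_set_scope.
Local Open Scope ring_scope.

(* R^n is 'rV[R]_n and R^N is {ptws nat -> R}, with the topologies of the
   library. *)
Notation borelType T := (g_sigma_algebraType (@open T)).

(* Coordinates are indexed from 0: the mathematical x_1, ..., x_n are the
   entries of index 0, ..., n - 1, both for vectors and for sequences. *)
Definition cylinderS (R : realType) (n : nat) (A : set 'rV[R]_n) :
    set 'rV[R]_n.+1 :=
  [set x | A (\row_(i < n) x ord0 (widen_ord (leqnSn n) i))].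

Definition cylinder (R : realType) (n : nat) (A : set 'rV[R]_n) :
    set {ptws nat -> R} :=
  [set x | A (\row_(i < n) x i)].

(* Main.v *)
From HB Require Import structures.
Require Import Defs.
From mathcomp Require Import all_boot all_order all_algebra.
From mathcomp Require Import finmap ring.
From mathcomp Require Import all_classical all_reals all_analysis.

Set Implicit Arguments.
Unset Strict Implicit.
Unset Printing Implicit Defensive.

Import Order.TTheory GRing.Theory Num.Theory.
Import numFieldNormedType.Exports.
Local Open Scope classical_set_scope.
Local Open Scope ring_scope.

(** The proof goes through the measure extension theorem. The cylinders form
    an algebra of sets, and consistency says exactly that the value
    [mu_ n A] given to [cylinder A] does not depend on the level [n] at which
    the cylinder is presented; at a common level additivity is that of
    [mu_ n], so this defines a content. If the content is countably
    subadditive, it extends to the sigma-algebra generated by the cylinders,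
    and that sigma-algebra contains the open sets, because an open set of the
    product topology is a countable union of open cylinders
    ([ptws_open_bigcup_cylinder]).

    Countable subadditivity ([cylinder_content_sigma_subadditive]) is where
    compactness enters. Let a cylinder [X] be
    covered by cylinders [F k], and let [e > 0]. Finite Borel measures on R^n
    are regular ([regular_borel]), so [X] can be shrunk to a closed cylinder
    [X'] and each [F k] enlarged to an open cylinder [G k], at a total cost of
    at most [2 e]. Moreover there are bounds [M i] such that the cylinders
    [M i < `|x i|] have total content at most [e] ([coordinate_tight]). The
    box of the sequences with [`|x i| <= M i] for all [i] is compact by
    Tychonoff's theorem, so finitely many [G k] cover its intersection with
    [X']. These [G k] and [X'] constrain only the first coordinates, up to some
    index [L]; since coordinates beyond [L] may be reset to 0, these [G k]
    together with the cylinders [M i < `|x i|] for [i <= L] cover the whole of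
    [X'] ([cylinder_finite_cover]). Finite subadditivity concludes. *)

(** * Borel sets and finite measures *)

Lemma continuous_borel_preimage (T U : ptopologicalType) (f : T -> U)
    (A : set (borelType U)) :
  continuous f -> measurable A -> measurable (f @^-1` A : set (borelType T)).
Proof.
move=> /continuousP cf mA.
have mf : measurable_fun setT (f : borelType T -> borelType U).
  apply: (@measurability _ _ (borelType T) (borelType U) setT f (@open U)) => //.
  move=> _ [B oB <-].
  by rewrite setTI; apply: sub_gen_smallest; exact: cf.
by rewrite -[X in measurable X]setTI; exact: mf.
Qed.

Lemma open_borel (T : ptopologicalType) (A : set T) :
  open A -> measurable (A : set (borelType T)).
Proof. exact: sub_gen_smallest. Qed.

Lemma closed_borel (T : ptopologicalType) (A : set T) :
  closed A -> measurable (A : set (borelType T)).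
Proof.
move=> cA; rewrite -(setCK (A : set (borelType T))).
by apply: measurableC; apply: open_borel; exact: closed_openC.
Qed.

Lemma nonincreasing_mu_lt d (T : measurableType d) (R : realType)
    (mu : {finite_measure set T -> \bar R}) (F : (set T)^nat) (e : \bar R) :
  (forall n, measurable (F n)) -> nonincreasing_seq F ->
  (mu (\bigcap_n F n) < e)%E -> exists n, (mu (F n) < e)%E.
Proof.
move=> mF niF lt_e.
have fin : (mu (F 0%N) < +oo)%E by rewrite ltey_eq fin_num_measure.
have cvgF := nonincreasing_cvg_mu fin mF (bigcapT_measurable mF) niF.
have := cvgF [set x | (x < e)%E].
case; first by apply: open_nbhs_nbhs; split => //; exact: open_ereal_lt_ereal.
by move=> N _ /(_ N (leqnn N)); exists N.
Qed.

Lemma content_le_cover2 d (T : ringOfSetsType d) (R : realFieldType)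
    (m : {content set T -> \bar R}) (A B C : set T) :
  measurable A -> measurable B -> measurable C -> A `<=` B `|` C ->
  (m A <= m B + m C)%E.
Proof.
move=> mA mB mC ABC; apply: le_trans (measureU2 m mB mC).
by apply: le_measure; rewrite ?inE//; exact: measurableU.
Qed.

(** * Regularity of finite Borel measures *)

Section regularity.
Context {R : realType} {T : pseudoMetricNormedZmodType R}.
Variable mu : {finite_measure set (borelType T) -> \bar R}.
Local Open Scope ereal_scope.

(** Inner and outer approximation are required together, since this makes the
    notion visibly stable under complement. *)
Definition regular_set (A : set T) := forall e : R, (0 < e)%R ->
  exists F U : set T, [/\ closed F, open U, F `<=` A, A `<=` U &
    mu (U `\` F) < e%:E].

(** An open set is the increasing union of the closed sets of the points at
    distance at least [n.+1%:R^-1] from its complement. *)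
Lemma regular_open (U : set T) : open U -> regular_set U.
Proof.
move=> oU e e0.
pose O n := \bigcup_(y in ~` U) ball y n.+1%:R^-1.
have oO n : open (O n) by apply: bigcup_open => y _; exact: ball_open.
have niUO : nonincreasing_seq (fun n => U `&` O n).
  move=> m n mn; apply/subsetPset; apply: setIS => x [y Uy xy]; exists y => //.
  by apply: le_ball xy; rewrite lef_pV2 ?posrE// ler_nat.
have UO0 : \bigcap_n (U `&` O n) = set0.
  rewrite -subset0 => x xUO.
  have [Ux _] := xUO 0%N I.
  have /nbhs_ballP[r /= r0 rU] : nbhs x U by apply: open_nbhs_nbhs.
  near \oo%classic => n.
  have [_ [y Uy xy]] := xUO n I.
  apply: Uy; apply: rU; apply: ball_sym; apply: le_ball xy.
  by apply/ltW; near: n; exact: near_infty_natSinv_lt (PosNum r0).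
have [||n] := @nonincreasing_mu_lt _ _ _ mu _ e%:E _ niUO.
- by move=> n; apply: open_borel; exact: openI.
- by rewrite UO0 measure0 lte_fin.
move=> lte; exists (~` O n), U; split => //.
- exact: open_closedC.
- move=> x Ox; apply: contrapT => Ux; apply: Ox; exists x => //.
  exact: ballxx.
- by rewrite setDE setCK.
Unshelve. all: by end_near. Qed.

Lemma regular_setC (A : set T) : regular_set A -> regular_set (~` A).
Proof.
move=> rA e e0; have [F [U [cF oU FA AU lte]]] := rA e e0.
exists (~` U), (~` F); split; [exact: open_closedC|exact: closed_openC| | |].
- exact: subsetC.
- exact: subsetC.
- by rewrite setDE setCK setIC -setDE.
Qed.

(** The union of the open approximations is open, but that of the closed ones
    is not closed: continuity of the measure along decreasing sequences allows
    keeping only finitely many of them. *)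
Lemma regular_bigcup (A : (set T)^nat) :
  (forall n, regular_set (A n)) -> regular_set (\bigcup_n A n).
Proof.
move=> rA e e0.
have e2 n : (0 < (e / 2) / (2 ^ n.+1)%:R)%R by rewrite !divr_gt0.
have /choice[F /choice[U FU]] n := rA n _ (e2 n).
pose V := \bigcup_n U n; pose G n := \big[setU/set0]_(k < n) F k.
have mD n : measurable (U n `\` F n : set (borelType T)).
  have [cF oU _ _ _] := FU n.
  by apply: measurableD; [exact: open_borel|exact: closed_borel].
have cG n : closed (G n).
  rewrite /G; elim/big_ind : _ => [| |i _]; [exact: closed0|exact: closedU|].
  by have [] := FU i.
have oV : open V by apply: bigcup_open => n _; have [] := FU n.
have niVG : nonincreasing_seq (fun n => V `\` G n).
  move=> m n mn; apply/subsetPset; apply: setDS => x; rewrite /G -!bigcup_mkord.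
  move=> -[k /= km Fkx]; exists k => //=.
  exact: leq_trans km mn.
have VG : \bigcap_n (V `\` G n) `<=` \bigcup_n (U n `\` F n).
  move=> x xVG; have [[k _ Ukx] _] := xVG 0%N I.
  exists k => //; split=> // Fkx.
  have [_] := xVG k.+1 I; apply; rewrite /G -bigcup_mkord.
  by exists k => /=.
have mVG n : measurable (V `\` G n : set (borelType T)).
  by apply: measurableD; [exact: open_borel|exact: closed_borel].
have [||n lte] := @nonincreasing_mu_lt _ _ _ mu _ e%:E _ niVG => //.
  have le1 : mu (\bigcap_n (V `\` G n)) <= \sum_(n <oo) mu (U n `\` F n).
    apply: measure_sigma_subadditive => //.
    exact: bigcapT_measurable.
  apply: (le_lt_trans le1); apply: (@le_lt_trans _ _ (e / 2)%:E).
    apply: le_trans (epsilon_trick0 xpredT _); last by rewrite divr_ge0// ltW.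
    by apply: lee_nneseries => // n _; have [_ _ _ _ /ltW] := FU n.
  by rewrite lte_fin ltr_pdivrMr// ltr_pMr// ltr1n.
exists (G n), V; split => //.
- rewrite /G -bigcup_mkord => x [k _ Fkx]; exists k => //.
  by have [_ _ FA _ _] := FU k; exact: FA.
- by move=> x [k _ Akx]; exists k => //; have [_ _ _ AU _] := FU k; exact: AU.
Qed.

Lemma regular_borel (A : set (borelType T)) : measurable A -> regular_set A.
Proof.
apply: smallest_sub; last exact: regular_open.
split.
- by apply: regular_open; exact: open0.
- by move=> B rB; rewrite setTD; exact: regular_setC.
- exact: regular_bigcup.
Qed.

End regularity.

(** * The sequence space and its cylinders *)

Section sequence_space.
Context {R : realType}.
Implicit Types (x y : {ptws nat -> R}) (n k : nat).

Lemma rV_continuous (T : topologicalType) n (f : T -> 'rV[R]_n) :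
  (forall i, continuous (fun t => f t ord0 i)) -> continuous f.
Proof.
move=> cf t A [P Pft PA].
have : \forall s \near t, forall i, P ord0 i (f s ord0 i).
  by apply: filter_forall => i; exact: cf.
by apply: filterS => s Ps; apply: PA => i j; rewrite (ord1 i); exact: Ps.
Qed.

Definition prefix n x : 'rV[R]_n.+1 := \row_(i < n.+1) x i.

(** A section of [prefix n]: it recovers the base of a cylinder as a preimage,
    and [pad (prefix n x)] resets the coordinates of [x] beyond [n] to 0. *)
Definition pad n (v : 'rV[R]_n.+1) : {ptws nat -> R} :=
  fun i => if (i <= n)%N then v ord0 (inord i) else 0.

Lemma pad_prefix n x i : (i <= n)%N -> pad (prefix n x) i = x i.
Proof. by move=> le_in; rewrite /pad le_in mxE inordK. Qed.

Lemma prefixK n (v : 'rV[R]_n.+1) : prefix n (pad v) = v.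
Proof.
by apply/rowP => i; rewrite mxE /pad -ltnS ltn_ord inord_val.
Qed.

Lemma prefix_continuous n : continuous (prefix n).
Proof.
apply: rV_continuous => i.
rewrite (_ : (fun x => _) = proj (i : nat)); last first.
  by apply/funext => x; rewrite mxE.
exact: proj_continuous.
Qed.

Lemma cylinderS_measurable n (A : set (borelType 'rV[R]_n.+1)) :
  measurable A -> measurable (cylinderS A : set (borelType 'rV[R]_n.+2)).
Proof.
apply: (@continuous_borel_preimage 'rV[R]_n.+2 'rV[R]_n.+1
  (fun v => \row_(i < n.+1) v ord0 (widen_ord (leqnSn n.+1) i))).
apply: rV_continuous => i.
rewrite (_ : (fun v => _) =
    (fun v : 'rV_n.+2 => v ord0 (widen_ord (leqnSn n.+1) i))); last first.
  by apply/funext => v; rewrite mxE.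
exact: coord_continuous.
Qed.

Lemma cylinder_cylinderS n (A : set 'rV[R]_n) :
  cylinder (cylinderS A) = cylinder A.
Proof.
apply/seteqP; split=> x /=; rewrite /cylinder /cylinderS /=;
by congr A; apply/rowP => i; rewrite !mxE.
Qed.

Lemma preimage_pad_cylinder n (A : set 'rV[R]_n.+1) :
  @pad n @^-1` cylinder A = A.
Proof.
by apply/seteqP; split=> v; rewrite /cylinder /= -/(prefix _ _) prefixK.
Qed.

(** The cylinders of a given level form a sigma-algebra, increasing with the
    level ([cylinder_atW]); finite families are handled by moving to a common
    level. *)
Definition cylinder_at n : set (set {ptws nat -> R}) :=
  [set cylinder A | A in (@measurable _ (borelType 'rV[R]_n.+1))].

Lemma cylinder_atW n k X : (n <= k)%N -> cylinder_at n X -> cylinder_at k X.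
Proof.
move=> /subnK <-; elim: (k - n)%N => // j IH /IH [A mA <-].
exists (cylinderS A); first exact: cylinderS_measurable.
exact: cylinder_cylinderS.
Qed.

Lemma cylinder_at_common X Y n k : cylinder_at n X -> cylinder_at k Y ->
  exists l, cylinder_at l X /\ cylinder_at l Y.
Proof.
move=> nX kY; exists (maxn n k); split.
  exact: cylinder_atW (leq_maxl _ _) nX.
exact: cylinder_atW (leq_maxr _ _) kY.
Qed.

(** Membership in a cylinder ignores the coordinates beyond its level. *)
Lemma cylinder_at_pad n k X x : (n <= k)%N -> cylinder_at n X ->
  X (pad (prefix k x)) <-> X x.
Proof.
move=> nk /(cylinder_atW nk)[A _ <-].
by rewrite /cylinder /= -!/(prefix _ _) prefixK.
Qed.

Lemma cylinder_atC n X : cylinder_at n X -> cylinder_at n (~` X).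
Proof. by move=> [A mA <-]; exists (~` A) => //; exact: measurableC. Qed.

Lemma cylinder_atU n X Y :
  cylinder_at n X -> cylinder_at n Y -> cylinder_at n (X `|` Y).
Proof.
by move=> [A mA <-] [B mB <-]; exists (A `|` B) => //; exact: measurableU.
Qed.

Definition is_cylinder : set (set {ptws nat -> R}) :=
  [set X | exists n, cylinder_at n X].

Lemma is_cylinder0 : is_cylinder set0.
Proof. by exists 0%N, set0. Qed.

Lemma is_cylinderU : setU_closed is_cylinder.
Proof.
move=> X Y [n nX] [k kY]; have [l [lX lY]] := cylinder_at_common nX kY.
by exists l; exact: cylinder_atU.
Qed.

Lemma is_cylinderC : setC_closed is_cylinder.
Proof. by move=> X [n nX]; exists n; exact: cylinder_atC. Qed.

(** Around each of its points, [U] contains a basic neighborhood, which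
    constrains finitely many coordinates, hence the first [n.+1] ones for some
    [n]. The level-[n] part of [U] is the largest open cylinder of level [n]
    inside [U], so no countable basis is needed. *)
Lemma ptws_open_bigcup_cylinder (U : set {ptws nat -> R}) : open U ->
  U = \bigcup_n cylinder [set v : 'rV[R]_n.+1 |
                           forall y, prefix n y = v -> U y]°.
Proof.
move=> oU; apply/seteqP; split; last first.
  by move=> x [n _] /interior_subset/(_ x); exact.
move=> x Ux.
pose D := [set ne : nat * R | 0 < ne.2].
pose B (ne : nat * R) := [set y : {ptws nat -> R} |
  forall i, (i <= ne.1)%N -> ball (x i) ne.2 (y i)].
have FF : Filter (filter_from D B).
  apply: filter_from_filter; first by exists (0%N, 1); rewrite /D /=.
  move=> [n e] [k d] /= e0 d0; exists (maxn n k, Num.min e d).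
    by rewrite /D /= lt_min e0 d0.
  move=> y xy; split=> i ik /=.
    apply: (le_ball _ (xy i _)); first by rewrite ge_min lexx.
    by rewrite leq_max ik.
  apply: (le_ball _ (xy i _)); first by rewrite ge_min lexx orbT.
  by rewrite leq_max ik orbT.
(* Convergence in the product topology is coordinatewise, so the sets [B]
   generate a filter that is finer than the neighborhoods of [x]. *)
have : {ptws, filter_from D B --> x}.
  apply/pointwise_cvgP => i A /nbhs_ballP[e /= e0 eA].
  by exists (i, e) => // y /(_ i (leqnn i)) /eA.
have Ux' : nbhs x U by apply: open_nbhs_nbhs.
move=> /(_ _ Ux')[[n e] /= e0 BU].
exists n => //; rewrite /cylinder /= -/(prefix _ _).
apply/nbhs_ballP; exists e => //= v [_ xv] y yv; apply: BU => i ni.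
have := xv ord0 (Ordinal (ni : (i < n.+1)%N)).
by rewrite -yv !mxE.
Qed.

End sequence_space.

(** * Finite subcovers of closed cylinders *)

Section cylinder_compactness.
Context {R : realType}.
Implicit Types (X : set {ptws nat -> R}).

Lemma box_compact (M : nat -> R) :
  compact [set x : {ptws nat -> R} | forall i, x i \in `[- M i, M i]].
Proof.
apply: (@tychonoff nat (fun=> R) (fun i => [set` `[- M i, M i]])) => i.
exact: segment_compact.
Qed.

(** [compact_cover] is about pointed spaces, hence the explicit structure
    [W]. *)
Lemma ptws_compact_cover (K : set {ptws nat -> R}) :
  compact K -> cover_compact K.
Proof.
pose W : ptopologicalType := HB.pack {ptws nat -> R} (Pointed.on (nat -> R)).
by rewrite -(@compact_cover W).
Qed.

(** A closed cylinder is not compact in general, but it admits finite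
    subcovers once the region where some coordinate [x i] exceeds [M i] is
    discarded, and finitely many coordinates [i] suffice for this. *)
Lemma cylinder_finite_cover (M : nat -> R) X (G : (set {ptws nat -> R})^nat) :
  (forall i, 0 <= M i) ->
  closed X -> is_cylinder X ->
  (forall k, open (G k)) -> (forall k, is_cylinder (G k)) ->
  X `<=` \bigcup_k G k ->
  exists N, X `<=` \big[setU/set0]_(k < N) G k `|`
    \big[setU/set0]_(i < N) [set x : {ptws nat -> R} | M i < `|x i|].
Proof.
move=> M0 cX [n nX] oG /choice[p pG] XG.
pose K := X `&` [set x : {ptws nat -> R} | forall i, x i \in `[- M i, M i]].
have : cover_compact K.
  apply: ptws_compact_cover; rewrite /K setIC.
  exact: compact_closedI (@box_compact M) cX.
move=> /(_ nat setT G)[//|x [/XG]//|D _ KD].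
(* [L] bounds the number of sets used, their levels and that of [X]. *)
pose f k := maxn k (p k).
pose N := \max_(k <- enum_fset D) f k.
pose L := maxn n N.
have DN k : k \in D -> (k <= N)%N /\ (p k <= N)%N.
  move=> kD; have := @leq_bigmax_seq _ _ xpredT f k kD isT.
  by rewrite geq_max => /andP[].
pose H i := [set y : {ptws nat -> R} | M i < `|y i|].
exists L.+1 => x Xx; rewrite -bigcup_mkord -(bigcup_mkord _ H).
have [Hx|/forallNP Hx] := pselect (exists i, (i <= L)%N /\ M i < `|x i|).
  by right; case: Hx => i [iL Mx]; exists i.
have xM i : (i <= L)%N -> `|x i| <= M i.
  by move=> iL; rewrite leNgt; apply/negP => ?; exact: (Hx i).
(* [x] may leave the box beyond [L]; its truncation [y] does not, and the
   cylinders at hand do not separate them. *)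
left; pose y : {ptws nat -> R} := pad (prefix L x).
have Ky : K y.
  split; first by apply/(cylinder_at_pad _ _ nX) => //; exact: leq_maxl.
  move=> i /=; rewrite in_itv /= -ler_norml.
  have [iL|Li] := leqP i L; first by rewrite /y pad_prefix// xM.
  by rewrite /y /pad leqNgt Li /= normr0.
have [k /= kD Gy] := KD _ Ky; have [kN pN] := DN _ kD.
exists k; first by rewrite /= ltnS (leq_trans kN)// leq_maxr.
exact/(cylinder_at_pad x (leq_trans pN (leq_maxr n N)) (pG k)).
Qed.

End cylinder_compactness.

(** * The content of cylinders *)

(** A copy of the sequence space whose measurable sets are the cylinders. *)
Definition cylinder_algebra (R : realType) : Type := {ptws nat -> R}.

HB.instance Definition _ (R : realType) :=
  Pointed.copy (cylinder_algebra R) {ptws nat -> R}.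

HB.instance Definition _ (R : realType) :=
  isAlgebraOfSets.Build default_measure_display (cylinder_algebra R)
    is_cylinder0 is_cylinderU is_cylinderC.

Section cylinder_content.
Context {R : realType}.
Variable mu_ : forall n : nat, probability (borelType 'rV[R]_n.+1) R.
Hypothesis consistent : forall (n : nat) (A : set (borelType 'rV[R]_n.+1)),
  measurable A -> mu_ n.+1 (cylinderS A) = mu_ n A.
Local Open Scope ereal_scope.
Implicit Types X : set (cylinder_algebra R).

Let level X := xget 0%N [set n | cylinder_at n X].

(** Any level would do, by [cylinder_contentE]. *)
Definition cylinder_content X : \bar R :=
  mu_ (level X) (@pad R (level X) @^-1` X).

(** Consistency, iterated along the levels. *)
Lemma mu_pad_cylinder n k X : (n <= k)%N -> cylinder_at n X ->
  mu_ k (@pad R k @^-1` X) = mu_ n (@pad R n @^-1` X).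
Proof.
move=> /subnK <- nX; elim: (k - n)%N => // j IH; rewrite -IH.
have [A mA <-] := cylinder_atW (leq_addl j n) nX.
by rewrite -{1}cylinder_cylinderS addSn !preimage_pad_cylinder consistent.
Qed.

Lemma cylinder_contentE n X : cylinder_at n X ->
  cylinder_content X = mu_ n (@pad R n @^-1` X).
Proof.
move=> nX; have lX : cylinder_at (level X) X.
  by apply: (@xgetPex _ 0%N [set l | cylinder_at l X]); exists n.
by rewrite /cylinder_content -(mu_pad_cylinder (leq_maxl _ n) lX)
  (mu_pad_cylinder (leq_maxr _ _) nX).
Qed.

Lemma cylinder_content_cylinder n (A : set (borelType 'rV[R]_n.+1)) :
  measurable A -> cylinder_content (cylinder A) = mu_ n A.
Proof.
by move=> mA; rewrite (@cylinder_contentE n) ?preimage_pad_cylinder//; exists A.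
Qed.

Lemma cylinder_content_ge0 X : 0 <= cylinder_content X.
Proof. exact: measure_ge0. Qed.

Lemma cylinder_content_semi_additive :
  measure_function.semi_additive cylinder_content.
Proof.
have m0 : cylinder_content set0 = 0.
  by rewrite /cylinder_content preimage_set0 measure0.
apply/(additive2P m0) => X Y [n nX] [k kY] XY0.
(* At the common level [l] the bases are disjoint as well, because [pad] is a
   section of [prefix l]. *)
have [l [[A mA AX] [B mB BY]]] := cylinder_at_common nX kY.
move: XY0; rewrite -AX -BY => AB0.
have -> : cylinder A `|` cylinder B = cylinder (A `|` B) by [].
rewrite !cylinder_content_cylinder//; last exact: measurableU.
rewrite measureU//.
have : @pad R l @^-1` (cylinder A `&` cylinder B) = set0.
  by rewrite AB0 preimage_set0.
by rewrite preimage_setI !preimage_pad_cylinder.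
Qed.

HB.instance Definition _ := isContent.Build _ _ _ cylinder_content
  cylinder_content_ge0 cylinder_content_semi_additive.

(** Preimages by the continuous map [prefix n] of the approximations of the
    base of the cylinder. *)
Lemma cylinder_regular X (e : R) : measurable X -> (0 < e)%R ->
  exists F G : set {ptws nat -> R}, [/\ closed F /\ open G,
    is_cylinder F /\ is_cylinder G, F `<=` X, X `<=` G &
    cylinder_content (G `\` F) < e%:E].
Proof.
move=> [n [A mA <-]] e0.
have [F [U [cF oU FA AU lte]]] := @regular_borel R _ (mu_ n) A mA e e0.
have cp := @prefix_continuous R n.
have mF := closed_borel cF; have mU := open_borel oU.
exists (cylinder F), (cylinder U); split.
- split; first by apply: (closed_comp _ cF) => x _; exact: cp.
  by apply: (open_comp _ oU) => x _; exact: cp.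
- by split; exists n; [exists F|exists U].
- by move=> x; exact: FA.
- by move=> x; exact: AU.
- have -> : cylinder U `\` cylinder F = cylinder (U `\` F) by [].
  by rewrite cylinder_content_cylinder//; exact: measurableD.
Qed.

Let last_gt i (M : R) : set 'rV[R]_i.+1 := [set v | M < `|v ord0 ord_max|]%R.

Let cylinder_last_gt i (M : R) :
  cylinder (@last_gt i M) = [set x : {ptws nat -> R} | M < `|x i|]%R.
Proof. by apply/seteqP; split=> x; rewrite /cylinder /last_gt /= mxE. Qed.

Let last_gt_borel i (M : R) :
  measurable (@last_gt i M : set (borelType 'rV[R]_i.+1)).
Proof.
apply: open_borel.
apply: (@open_comp _ _ (fun v : 'rV[R]_i.+1 => `|v ord0 ord_max|%R)
  [set r | M < r]%R); last exact: open_gt.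
move=> v _; apply: continuous_comp; first exact: coord_continuous.
exact: norm_continuous.
Qed.

(** The sets [k%:R < `|x i|] decrease to the empty set as [k] grows. *)
Lemma coordinate_tight i (e : R) : (0 < e)%R -> exists M : R, (0 <= M)%R /\
  cylinder_content [set x : {ptws nat -> R} | M < `|x i|]%R < e%:E.
Proof.
move=> e0.
have niB : nonincreasing_seq (fun k => @last_gt i k%:R).
  move=> k l kl; apply/subsetPset => v; apply: le_lt_trans.
  by rewrite ler_nat.
have [|k lte] := @nonincreasing_mu_lt _ _ _ (mu_ i) _ e%:E
    (fun k => last_gt_borel k%:R) niB.
  rewrite (_ : \bigcap_k _ = set0) ?measure0 ?lte_fin//.
  rewrite -subset0 => v /(_ (Num.truncn `|v ord0 ord_max|%R).+1 I).
  by apply/negP; rewrite -leNgt ltW// truncnS_gt.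
exists k%:R; split=> //.
by rewrite -cylinder_last_gt cylinder_content_cylinder.
Qed.

Lemma cylinder_content_sigma_subadditive :
  measurable_subset_sigma_subadditive cylinder_content.
Proof.
move=> X F mF mX XF; apply/lee_addgt0Pr => e' e'0.
(* One third is spent on shrinking [X], one on enlarging the sets [F k], and
   one on the unbounded coordinates. *)
have -> : e' = (e' / 3 + (e' / 3 + e' / 3))%R by field.
have : (0 < e' / 3)%R by rewrite divr_gt0.
move: (e' / 3)%R => e e0.
have e2 (n : nat) : (0 < e / (2 ^ n.+1)%:R)%R by rewrite divr_gt0.
have [X' [V [[cX' _] [mX' mV] X'X XV ltX]]] := cylinder_regular mX e0.
have /choice[F' /choice[G FG]] k := cylinder_regular (mF k) (e2 k).
have /choice[M HM] i := coordinate_tight i (e2 i).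
pose H i := [set x : {ptws nat -> R} | M i < `|x i|]%R.
have mH i : measurable (H i : set (cylinder_algebra R)).
  by exists i, (last_gt (M i)); rewrite ?cylinder_last_gt.
have mG k : measurable (G k : set (cylinder_algebra R)).
  by have [_ []] := FG k.
have [N X'N] : exists N, X' `<=` \big[setU/set0]_(k < N) G k `|`
                                 \big[setU/set0]_(i < N) H i.
  apply: cylinder_finite_cover => //.
  - by move=> i; have [] := HM i.
  - by move=> k; have [[]] := FG k.
  - move=> x /X'X/XF[k _ Fkx]; exists k => //.
    by have [_ _ _ FGk _] := FG k; exact: FGk.
have mGN : measurable (\big[setU/set0]_(k < N) G k : set (cylinder_algebra R)).
  exact: bigsetU_measurable.
have mHN : measurable (\big[setU/set0]_(k < N) H k : set (cylinder_algebra R)).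
  exact: bigsetU_measurable.
have leG : cylinder_content (\big[setU/set0]_(k < N) G k) <=
    \sum_(k <oo) cylinder_content (F k) + e%:E.
  apply: (le_trans (@Boole_inequality _ _ _ cylinder_content G N _)) => //.
  apply: le_trans (epsilon_trick _ _ (ltW e0)); last first.
    by move=> k; exact: cylinder_content_ge0.
  rewrite -(big_mkord xpredT (cylinder_content \o G)).
  apply: le_trans (nneseries_lim_ge N _) => [|k _ _]; last first.
    by rewrite adde_ge0 ?cylinder_content_ge0// lee_fin ltW.
  apply: lee_sum => k _ /=.
  have [_ [mF' _] F'F _ ltk] := FG k.
  have mGF : measurable (G k `\` F' k : set (cylinder_algebra R)).
    exact: measurableD.
  have GFk : G k `<=` F k `|` (G k `\` F' k).
    move=> x Gx; have [F'x|F'x] := pselect (F' k x); first by left; exact: F'F.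
    by right.
  apply: (le_trans (content_le_cover2 cylinder_content _ _ _ GFk)) => //.
  by rewrite leeD2l// ltW.
have leH : cylinder_content (\big[setU/set0]_(k < N) H k) <= e%:E.
  apply: (le_trans (@Boole_inequality _ _ _ cylinder_content H N _)) => //.
  apply: le_trans (epsilon_trick0 xpredT (ltW e0)).
  rewrite -(big_mkord xpredT (cylinder_content \o H)).
  apply: le_trans (nneseries_lim_ge N _) => [|k _ _]; last first.
    by rewrite lee_fin ltW.
  by apply: lee_sum => k _ /=; apply: ltW; have [] := HM k.
have mVX' : measurable (V `\` X' : set (cylinder_algebra R)).
  exact: measurableD.
have Xcov : X `<=` (V `\` X') `|`
    (\big[setU/set0]_(k < N) G k `|` \big[setU/set0]_(k < N) H k).
  move=> x Xx; have [X'x|X'x] := pselect (X' x); first by right; exact: X'N.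
  by left; split => //; exact: XV.
apply: (le_trans (content_le_cover2 cylinder_content _ _ _ Xcov)) => //.
  exact: measurableU.
rewrite EFinD addeCA; apply: leeD; first exact: ltW.
apply: (le_trans (measureU2 cylinder_content mGN mHN)).
by rewrite EFinD addeA leeD.
Qed.

(** * Extension to the Borel sets *)

HB.instance Definition _ := Content_SigmaSubAdditive_isMeasure.Build _ _ _
  cylinder_content cylinder_content_sigma_subadditive.

Let I : measurableType _ :=
  g_sigma_algebraType (@measurable _ (cylinder_algebra R)).

Lemma cylinder_sigma_borel :
  measurable_fun setT (fun x : I => x : borelType {ptws nat -> R}).
Proof.
apply: (@measurability _ _ I (borelType {ptws nat -> R}) setT _
  (@open {ptws nat -> R})) => //.
move=> _ [U oU <-]; rewrite setTI (ptws_open_bigcup_cylinder oU).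
rewrite preimage_bigcup; apply: bigcupT_measurable => n.
apply: sub_gen_smallest; exists n.
eexists; last reflexivity.
by apply: open_borel; exact: open_interior.
Qed.

Lemma kolmogorov_extension :
  exists mu : probability (borelType {ptws nat -> R}) R,
    forall (n : nat) (A : set (borelType 'rV[R]_n.+1)),
      measurable A -> mu (cylinder A) = mu_ n A.
Proof.
pose m := measure_extension cylinder_content.
have mE n (A : set (borelType 'rV[R]_n.+1)) :
    measurable A -> m (cylinder A) = mu_ n A.
  move=> mA; rewrite /m /measure_extension.
  rewrite measurable_mu_extE; last by exists n, A.
  exact: cylinder_content_cylinder.
have mT : m setT = 1 by rewrite -(@probability_setT _ _ _ (mu_ 0%N)) -mE.
(* The cylinders generate a sigma-algebra that contains the Borel sets, so the
   extension is restricted to the latter by taking the law of the identity. *)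
pose P : probability I R := HB.pack m (Measure_isProbability.Build _ _ _ m mT).
pose X : {mfun I >-> borelType {ptws nat -> R}} :=
  HB.pack (fun x : I => x : borelType {ptws nat -> R})
    (isMeasurableFun.Build _ _ _ _ _ cylinder_sigma_borel).
by exists (distribution P X).
Qed.

End cylinder_content.

(* mu_ n is the measure on R^(n+1), so that n : nat ranges over the
   dimensions 1, 2, ... *)
Theorem theorem1 (R : realType)
  (mu_ : forall n : nat, probability (borelType 'rV[R]_n.+1) R)
  (consistent : forall (n : nat) (A : set (borelType 'rV[R]_n.+1)),
    measurable A -> mu_ n.+1 (cylinderS A) = mu_ n A) :
  exists mu : probability (borelType {ptws nat -> R}) R,
    forall (n : nat) (A : set (borelType 'rV[R]_n.+1)),
      measurable A -> mu (cylinder A) = mu_ n A.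
Proof. exact: kolmogorov_extension. Qed.
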